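(* Let $f\in\mathcal S^0_{\mu_f}(\mathcal X)$ with $\mu_f\ge0$ and $g\in\mathcal S^0_{\mu_g}(\mathcal Y)$ with $\mu_g=0$. Let $\beta_k=k$, $\alpha_k=\frac1k$ and $\epsilon_k=\frac1{k^3}$ for $k\ge1$, and suppose that $\delta,\gamma>0$ satisfy $\delta\le1$ and $\delta\gamma-1\ge0$. Let $\{(x_k,y_k,\lambda_k)\}_{k\ge1}$ be the sequence generated by the Primal-dual Splitting Algorithm (defined in the context) with these parameters and let $(x^*,y^*,\lambda^* )\in\Omega$. Then the sequence $\{(x_k,y_k,\lambda_k)\}_{k\ge1}$ is bounded and, as $k\to+\infty$, $$\mathcal L(x_k,y_k,\lambda^* )-\mathcal L(x^*,y^*,\lambda^* )=\mathcal O\!\left(\frac1k\right),\quad |\Phi(x_k,y_k)-\Phi(x^*,y^* )|=\mathcal O\!\left(\frac1k\right),\quad \|Ax_k+By_k-b\|=\mathcal O\!\left(\frac1k\right).$$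
   Context: $\mathcal X,\mathcal Y,\mathcal Z$ are real Hilbert spaces. The problem is $\min_{x\in\mathcal X,y\in\mathcal Y}\Phi(x,y):=f(x)+g(y)$ subject to $Ax+By=b$, where $f:\mathcal X\to\mathbb R\cup\{+\infty\}$, $g:\mathcal Y\to\mathbb R\cup\{+\infty\}$ are proper, convex, lower semicontinuous, $A:\mathcal X\to\mathcal Z$, $B:\mathcal Y\to\mathcal Z$ are continuous linear operators, $b\in\mathcal Z$, and the set $\mathbb S$ of optimal solutions is nonempty. $\mathcal S^0_\mu(\mathcal X)$ ($\mu\ge0$) is the set of proper, closed, lower semicontinuous convex functions $f$ on $\mathcal X$ such that $f(x_1)-f(x_2)-\langle w,x_1-x_2\rangle\ge\frac\mu2\|x_1-x_2\|^2$ for all $x_1,x_2\in\mathcal X$ and $w\in\partial f(x_2)$ (convex subdifferential); similarly for $\mathcal Y$. Lagrangian: $\mathcal L(x,y,\lambda)=f(x)+g(y)+\langle\lambda,Ax+By-b\rangle$. Augmented Lagrangian: $\mathcal L_\theta(x,y,\lambda)=\mathcal L(x,y,\lambda)+\frac\theta2\|Ax+By-b\|^2$. $\Omega$ is the set of saddle points: $(x^*,y^*,\lambda^* )\in\Omega$ iff $\mathcal L(x^*,y^*,\lambda)\le\mathcal L(x^*,y^*,\lambda^* )\le\mathcal L(x,y,\lambda^* )$ for all $(x,y,\lambda)\in\mathcal X\times\mathcal Y\times\mathcal Z$. Primal-dual Splitting Algorithm. Parameters: $\delta>0$, $\gamma>0$, sequences $\alpha_k>0$, $\beta_k>0$, $\epsilon_k\ge0$.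 Initialize $x_1=x_0=\frac1\gamma Z_1$, $y_1=y_0=\frac1\gamma H_1$, $\lambda_1=\lambda_0$. For $k=1,2,\dots$: Step 1: $\theta_k=(\alpha_k+\delta)\beta_k$, $\eta_{f,k}=\gamma+\frac1{\alpha_k}+\mu_f\delta\beta_k$, $\widetilde\lambda_{1,k}=\lambda_k-\delta\beta_k(Ax_k+By_k-b)+\delta\alpha_k\beta_kB(H_k-\gamma y_k)$, $\widetilde x_k=x_k+\frac{Z_k-\gamma x_k}{\eta_{f,k}}$, $$x_{k+1}=\arg\min_{x\in\mathcal X}\Big(\mathcal L_{\theta_k}(x,y_k,\widetilde\lambda_{1,k})+\frac{\eta_{f,k}}{2\alpha_k\beta_k}\|x-\widetilde x_k\|^2+\frac{\epsilon_k}2\|x\|^2\Big),$$ $Z_{k+1}=\frac{x_{k+1}-x_k}{\alpha_k}+\gamma x_{k+1}$, $Z^\delta_{k+1}=\delta Z_{k+1}+(1-\delta\gamma)x_{k+1}$. Step 2: $\eta_{g,k}=\gamma+\frac1{\alpha_k}+\mu_g\delta\beta_k$, $\widetilde\lambda_{2,k}=\lambda_k-\delta\beta_k(Ax_k+By_k-b)$, $\widetilde y_k=y_k+\frac{H_k-\gamma y_k}{\eta_{g,k}}$, $$y_{k+1}=\arg\min_{y\in\mathcal Y}\Big(\mathcal L_{\theta_k}(x_{k+1},y,\widetilde\lambda_{2,k})+\frac{\eta_{g,k}}{2\alpha_k\beta_k}\|y-\widetilde y_k\|^2+\frac{\epsilon_k}2\|y\|^2\Big),$$ $H_{k+1}=\frac{y_{k+1}-y_k}{\alpha_k}+\gamma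 y_{k+1}$, $H^\delta_{k+1}=\delta H_{k+1}+(1-\delta\gamma)y_{k+1}$. Step 3: $\lambda_{k+1}=\lambda_k+\alpha_k\beta_k(AZ^\delta_{k+1}+BH^\delta_{k+1}-b)$. *)

(* Defs.v *)
From HB Require Import structures.
From mathcomp Require Import all_boot all_order all_algebra.
From mathcomp Require Import all_classical all_reals all_analysis.

Set Implicit Arguments.
Unset Strict Implicit.
Unset Printing Implicit Defensive.

Import Order.TTheory GRing.Theory Num.Theory.
Import numFieldNormedType.Exports.

Local Open Scope classical_set_scope.
Local Open Scope ring_scope.

HB.mixin Record isHilbert (R : realType) T of CompleteNormedModule R T := {
  inner : {dot T for idfun} ;
  inner_norm : forall x : T, inner x x = `|x| ^+ 2
}.

#[short(type="hilbertType")]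
HB.structure Definition Hilbert (R : realType) :=
  {T of CompleteNormedModule R T & isHilbert R T}.

Notation "''[' u , v ]" := (inner u%R v%R) : ring_scope.

Section ConvexAnalysis.
Context {R : realType} {T : hilbertType R}.
Implicit Types (f : T -> \bar R) (x w : T).

Definition proper_fun f :=
  (forall x, f x != -oo%E) /\ (exists x, (f x < +oo)%E).

Definition convex_efun f := forall x1 x2 (t : R), 0 <= t <= 1 ->
  (f (t *: x1 + (1 - t) *: x2)%R <= t%:E * f x1 + (1 - t)%:E * f x2)%E.

Definition epigraph f : set (T * R) := [set p | (f p.1 <= (p.2)%:E)%E].

(* For proper f this is empty at points where f is +oo. *)
Definition subdifferential f x : set T :=
  [set w | forall z, (f x + '[w, z - x]%:E <= f z)%E].

Definition strong_class (mu : R) : set (T -> \bar R) := [set f |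
  [/\ proper_fun f, closed (epigraph f), lower_semicontinuous f,
      convex_efun f &
      forall x1 x2 w, subdifferential f x2 w ->
        ((mu / 2 * `|x1 - x2| ^+ 2)%:E <= f x1 - f x2 - '[w, x1 - x2]%:E)%E]].

Definition argmin f : set T := [set x | forall z, (f x <= f z)%E].

End ConvexAnalysis.

Section Problem.
Context {R : realType} {X Y Z : hilbertType R}.
Variables (f : X -> \bar R) (g : Y -> \bar R) (A : X -> Z) (B : Y -> Z) (b : Z).

Definition objective x y : \bar R := (f x + g y)%E.

Definition residual x y : Z := A x + B y - b.

Definition optimal_solutions : set (X * Y) := [set p | residual p.1 p.2 = 0 /\
  forall x y, residual x y = 0 -> (objective p.1 p.2 <= objective x y)%E].

Definition lagrangian x y lam : \bar R :=
  (objective x y + '[lam, residual x y]%:E)%E.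

Definition aug_lagrangian (theta : R) x y lam : \bar R :=
  (lagrangian x y lam + (theta / 2 * `|residual x y| ^+ 2)%:E)%E.

Definition saddle_points : set (X * Y * Z) := [set p |
  forall x y lam,
    (lagrangian p.1.1 p.1.2 lam <= lagrangian p.1.1 p.1.2 p.2)%E /\
    (lagrangian p.1.1 p.1.2 p.2 <= lagrangian x y p.2)%E].

Variables (mu_f mu_g delta gamma : R) (alpha beta eps : nat -> R).

(* Zs and Hs are the auxiliary sequences Z_k and H_k.  An arg min equation says
   that the new iterate is the unique minimizer of the subproblem. *)
Record primal_dual_splitting (x : nat -> X) (y : nat -> Y) (lam : nat -> Z)
    (Zs : nat -> X) (Hs : nat -> Y) : Prop := {
  pds_init_x : x 1%N = x 0%N /\ x 0%N = gamma^-1 *: Zs 1%N ;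
  pds_init_y : y 1%N = y 0%N /\ y 0%N = gamma^-1 *: Hs 1%N ;
  pds_init_lam : lam 1%N = lam 0%N ;
  pds_step_x : forall k, (1 <= k)%N ->
    let theta := (alpha k + delta) * beta k in
    let eta_f := gamma + (alpha k)^-1 + mu_f * delta * beta k in
    let lam1 := lam k - (delta * beta k) *: residual (x k) (y k)
                + (delta * alpha k * beta k) *: B (Hs k - gamma *: y k) in
    let xt := x k + eta_f^-1 *: (Zs k - gamma *: x k) in
    argmin (fun u => (aug_lagrangian theta u (y k) lam1
      + (eta_f / (2 * alpha k * beta k) * `|u - xt| ^+ 2)%:E
      + (eps k / 2 * `|u| ^+ 2)%:E)%E) = [set x k.+1] ;
  pds_Z : forall k, (1 <= k)%N ->
    Zs k.+1 = (alpha k)^-1 *: (x k.+1 - x k) + gamma *: x k.+1 ;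
  pds_step_y : forall k, (1 <= k)%N ->
    let theta := (alpha k + delta) * beta k in
    let eta_g := gamma + (alpha k)^-1 + mu_g * delta * beta k in
    let lam2 := lam k - (delta * beta k) *: residual (x k) (y k) in
    let yt := y k + eta_g^-1 *: (Hs k - gamma *: y k) in
    argmin (fun v => (aug_lagrangian theta (x k.+1) v lam2
      + (eta_g / (2 * alpha k * beta k) * `|v - yt| ^+ 2)%:E
      + (eps k / 2 * `|v| ^+ 2)%:E)%E) = [set y k.+1] ;
  pds_H : forall k, (1 <= k)%N ->
    Hs k.+1 = (alpha k)^-1 *: (y k.+1 - y k) + gamma *: y k.+1 ;
  pds_step_lam : forall k, (1 <= k)%N ->
    let Zd := delta *: Zs k.+1 + (1 - delta * gamma) *: x k.+1 in
    let Hd := delta *: Hs k.+1 + (1 - delta * gamma) *: y k.+1 in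
    lam k.+1 = lam k + (alpha k * beta k) *: residual Zd Hd
}.

End Problem.

(* An extended-real sequence is O(v) when it is real-valued from some rank on
   and its real part is O(v); finiteness cannot be asked of every term since
   the starting point need not lie in the domain. *)
Definition ereal_bigO {R : realType} (u : nat -> \bar R) (v : nat -> R) :=
  (\forall k \near \oo, u k \is a fin_num) /\ (fine \o u =O_\oo v).

(* Main.v *)
Require Import Defs.
From HB Require Import structures.
From mathcomp Require Import all_boot all_order all_algebra.
From mathcomp Require Import all_classical all_reals all_analysis.
From mathcomp Require Import ring lra.

Set Implicit Arguments.
Unset Strict Implicit.
Unset Printing Implicit Defensive.

Import Order.TTheory GRing.Theory Num.Theory.
Import numFieldNormedType.Exports.

Local Open Scope classical_set_scope.
Local Open Scope ring_scope.

(* With [u k = x k + delta (Zs k - gamma x k)] and [v k] likewise, the algorithm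
   says [u (k+1) = x (k+1) + delta k (x (k+1) - x k)],
   [lam (k+1) - lam k = A (u (k+1) - xs) + B (v (k+1) - ys)], and the subproblems
   give subgradients of [f] and [g] at the new iterates.  Testing them at the
   saddle point [(xs, ys, lams)] and, with weight [delta k], at the previous
   iterate shows that the sum of [delta k] times the Lagrangian gap and of
     [|lam k - lams|^2 / 2 + |B (v k - ys)|^2 / 2,
      (|u k - xs|^2 + (delta gamma - 1) |x k - xs|^2) / (2 delta),
      (|v k - ys|^2 + (delta gamma - 1) |y k - ys|^2) / (2 delta),
      delta / (2 k^2) (|x k|^2 + |y k|^2)]
   grows by at most [(|xs|^2 + |ys|^2) / (2 k^3)] at each step [k >= 2]; its last
   term makes the contribution of the Tikhonov regularization telescope.  Hence
   this energy is bounded, and the rate for the residual follows from the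
   boundedness of [lam]. *)

(** For small [t] the linear term dominates. This is how first-order conditions are extracted from
    minimality along a segment. *)
Lemma ge0_of_quadratic {R : realFieldType} (a c : R) :
  (forall t, 0 < t <= 1 -> 0 <= t * a + t ^+ 2 * c) -> 0 <= a.
Proof.
move=> h; rewrite leNgt; apply/negP => a0.
have dp : 0 < `|c| - a by have := normr_ge0 c; lra.
(* With this [t], at most 1/2, [t * (|c| - a) = - a / 2], hence [a + t * c <= a / 2 < 0]. *)
have t0 : 0 < - a / (`|c| - a) / 2.
  by rewrite !divr_gt0// oppr_gt0.
have E : - a / (`|c| - a) / 2 * (`|c| - a) = - a / 2.
  by field; rewrite gt_eqF.
have cc := ler_norm c; have c0 := normr_ge0 c.
have /h : 0 < - a / (`|c| - a) / 2 <= 1 by rewrite t0/=; nra.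
move: t0 E; set t := - a / _ / 2 => t0 E.
have -> : t * a + t ^+ 2 * c = t * (a + t * c) by ring.
rewrite pmulr_rge0//.
suff : t * c <= - a / 2 by lra.
by nra.
Qed.

(** * Inner products, Riesz representation and adjoints *)

Section Inner.
Context {R : realType} {T : hilbertType R}.
Implicit Types (x y z : T) (a : R).

Lemma innerC x y : '[x, y] = '[y, x].
Proof. by rewrite hermC/= mul1r. Qed.

Lemma innerDr x y z : '[x, y + z] = '[x, y] + '[x, z].
Proof. exact: linearDr. Qed.

Lemma innerDl x y z : '[y + z, x] = '[y, x] + '[z, x].
Proof. exact: linearDl. Qed.

Lemma innerNr x y : '[x, - y] = - '[x, y].
Proof. exact: linearNr. Qed.

Lemma innerNl x y : '[- y, x] = - '[y, x].
Proof. exact: linearNl. Qed.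

Lemma innerZr a x y : '[x, a *: y] = a * '[x, y].
Proof. exact: linearZr. Qed.

Lemma innerZl a x y : '[a *: y, x] = a * '[y, x].
Proof. exact: linearZl_LR. Qed.

Definition innerE := (innerDl, innerDr, innerNl, innerNr, innerZl, innerZr).

(** Cauchy-Schwarz, read off from the squared triangle inequality that the normed structure already
    supplies. *)
Lemma inner_le_norm x y : '[x, y] <= `|x| * `|y|.
Proof.
have : `|x + y| ^+ 2 <= (`|x| + `|y|) ^+ 2.
  by rewrite ler_pXn2r ?nnegrE ?addr_ge0// ler_normD.
by rewrite sqrrD -!inner_norm !innerE (innerC y x) mulr2n; lra.
Qed.

Lemma abs_inner_le_norm x y : `|'[x, y]| <= `|x| * `|y|.
Proof.
rewrite ler_norml inner_le_norm andbT lerNl -innerNl.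
by rewrite (le_trans (inner_le_norm _ _))// normrN.
Qed.

Lemma sqrnormD x y : `|x + y| ^+ 2 = `|x| ^+ 2 + 2 * '[x, y] + `|y| ^+ 2.
Proof. by rewrite -!inner_norm !innerE (innerC y x); ring. Qed.

(* The representing vector is the minimizer of [|u|^2 / 2 - phi u]; a minimizing
   sequence is Cauchy by the parallelogram law. *)
Lemma riesz_representation (phi : T -> R) : scalar phi ->
  (exists c : R, forall x, `|phi x| <= c * `|x|) ->
  exists v, forall x, phi x = '[v, x].
Proof.
move=> phiL [c phic].
have phiD x y : phi (x + y) = phi x + phi y.
  by rewrite -[x in LHS]scale1r phiL mul1r.
have phi0 : phi 0 = 0 by have := phiD 0 0; rewrite addr0; lra.
have phiZ a x : phi (a *: x) = a * phi x.
  by rewrite -[a *: x]addr0 phiL phi0 addr0.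
pose J x : R := `|x| ^+ 2 / 2 - phi x.
have JD x y : J (x + y) = J x + ('[x, y] - phi y) + `|y| ^+ 2 / 2.
  by rewrite /J phiD sqrnormD; lra.
have Jlb : has_inf (range J).
  split; first by exists (J 0), 0.
  exists (- (c ^+ 2 / 2)) => _ [x _ <-]; rewrite /J.
  have := phic x; have := ler_norm (phi x); have := sqr_ge0 (`|x| - c).
  rewrite sqrrB mulr2n; lra.
pose m := inf (range J).
have mJ x : m <= J x by apply: ge_inf; [exact: Jlb.2 | exists x].
have /choice[u Ju] : forall n : nat, exists x, J x < m + n.+1%:R^-1.
  move=> n; have [] := @inf_adherent _ (range J) n.+1%:R^-1 _ Jlb; first by [].
  by move=> _ [x _ <-] Jx; exists x.
have gap x y : `|x - y| ^+ 2 <= 4 * (J x - m + (J y - m)).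
  have := mJ (2^-1 *: (x + y)).
  rewrite /J phiZ phiD -!inner_norm !innerE (innerC y x); lra.
have /cvg_ex[v ucvg] : cvg (u @ \oo).
  apply/cauchy_cvgP/cauchy_exP => e e0.
  (* By [gap], a squared distance is at most 4 times the sum of two excesses over [m], each below
     [e ^+ 2 / 8]. *)
  have [N HN] : exists N : nat, N.+1%:R^-1 < e ^+ 2 / 8 :> R.
    have /ltr_add_invr[k] : 0 < e ^+ 2 / 8 by rewrite divr_gt0// exprn_gt0.
    by rewrite add0r; exists k.
  exists (u N); exists N => // n /= Nn.
  rewrite -ball_normE /= -(@ltr_pXn2r _ 2)// ?nnegrE// ?ltW//.
  rewrite (le_lt_trans (gap _ _))//.
  have : n.+1%:R^-1 <= N.+1%:R^-1 :> R by rewrite lef_pV2 ?posrE// ler_nat.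
  move: HN (Ju n) (Ju N); move: (n.+1%:R^-1) (N.+1%:R^-1) => p q; lra.
exists v.
have Jv : J v <= m.
  have phicont : phi \o u @ \oo --> phi v.
    apply/cvgrPdistC_le => e e0; near=> n.
    have c1 : 0 < `|c| + 1 by rewrite ltr_pwDr.
    have -> : (phi \o u) n - phi v = phi (u n - v).
      by rewrite phiD -(scaleN1r v) phiZ mulN1r.
    rewrite (le_trans (phic _))// (@le_trans _ _ ((`|c| + 1) * `|u n - v|))//.
      by rewrite ler_wpM2r// (le_trans (ler_norm c))// lerDl.
    rewrite -ler_pdivlMl//; near: n.
    have /cvgrPdistC_le := ucvg; apply; rewrite mulr_gt0// invr_gt0.
  have Jcont : (J \o u) n - n.+1%:R^-1 @[n --> \oo] --> J v - 0.
    apply: cvgB; last exact: cvg_harmonic.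
    apply: cvgB => //; apply: cvgMl; rewrite expr2.
    have h : `|u n| @[n --> \oo] --> `|v| by exact: cvg_norm.
    by under eq_fun do rewrite expr2; apply: cvgM.
  rewrite subr0 in Jcont.
  apply: (cvgr_to_le Jcont).
  by near=> n; rewrite /= lerBlDr ltW.
have first_order w : 0 <= '[v, w] - phi w.
  apply: (@ge0_of_quadratic _ _ (`|w| ^+ 2 / 2)) => t _.
  have := mJ (v + t *: w); rewrite JD -!inner_norm !innerE phiZ.
  by move: Jv; rewrite /=; lra.
move=> x; apply/eqP; rewrite eq_le -subr_ge0 first_order/=.
by have := first_order (- x); rewrite -(scaleN1r x) phiZ innerZr; lra.
Unshelve. all: by end_near.
Qed.
End Inner.
(** Riesz applied to [x |-> '[l, L x]]. It turns the coupling term of a subproblem into a vector of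
    the primal space, as a subgradient requires. *)
Lemma adjoint_exists {R : realType} {T Z : hilbertType R}
    (L : {linear T -> Z}) : continuous L ->
  forall l, exists v, forall x, '[l, L x] = '[v, x].
Proof.
move=> /linear_bounded_continuous/linear_boundedP/pinfty_ex_gt0[M M0 LM] l.
apply: riesz_representation => [a x y|].
  by rewrite linearP innerDr innerZr.
exists (`|l| * M) => x; rewrite (le_trans (abs_inner_le_norm _ _))//.
by rewrite -mulrA ler_wpM2l.
Qed.

(** * First-order optimality for a convex function plus a quadratic *)

Section FirstOrder.
Context {R : realType} {T : hilbertType R}.
Implicit Types (h : T -> \bar R) (Q : T -> R).

Lemma minimizer_fin_num h Q x : proper_fun h ->
  (forall z, (h x + (Q x)%:E <= h z + (Q z)%:E)%E) -> h x \is a fin_num.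
Proof.
move=> [hNy [z hz]] hmin; rewrite fin_numE hNy/=; apply/negP => /eqP hx.
have := hmin z; rewrite hx; move: hz (hNy z).
by case: (h z).
Qed.

(** Fermat's rule without a subdifferential sum rule: compare [x] with [x + t *: (z - x)], bound [h]
    there by convexity, and let the first-order part in [t] decide. *)
Lemma minimizer_subdifferential h Q x w (c : T -> R) :
  proper_fun h -> convex_efun h ->
  (forall z, (h x + (Q x)%:E <= h z + (Q z)%:E)%E) ->
  (forall d t, Q (x + t *: d) = Q x + t * '[w, d] + t ^+ 2 * c d) ->
  subdifferential h x (- w).
Proof.
move=> hproper hconv hmin Qexp z.
have /fineK := minimizer_fin_num hproper hmin.
set a := fine _ => hx; rewrite -hx.
have := hproper.1 z; case Ez : (h z) => [b| |] // _; last by rewrite leey.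
rewrite -EFinD lee_fin innerNl -subr_ge0.
apply: (@ge0_of_quadratic _ _ (c (z - x))) => t /andP[t0 t1].
have := hmin (x + t *: (z - x)); rewrite Qexp -hx.
have -> : x + t *: (z - x) = t *: z + (1 - t) *: x.
  by rewrite scalerBr scalerBl scale1r addrCA.
have := hconv z x t; rewrite (ltW t0) t1 -hx Ez => /(_ isT).
case: (h _) => [r| |] //.
by rewrite -!EFinM -!EFinD !lee_fin; lra.
Qed.

Lemma strong_class_minimizer {Z : hilbertType R} (L : {linear T -> Z}) h
    mu x p l s (c0 theta a e : R) : continuous L -> strong_class mu h ->
  let Q u := c0 + ('[l, L u + s] + (theta / 2 * `|L u + s| ^+ 2 +
    (a * `|u - p| ^+ 2 + e / 2 * `|u| ^+ 2))) in
  (forall z, (h x + (Q x)%:E <= h z + (Q z)%:E)%E) ->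
  h x \is a fin_num /\ forall z, h z \is a fin_num ->
    fine (h x) + mu / 2 * `|z - x| ^+ 2 <= fine (h z)
      + '[l + theta *: (L x + s), L (z - x)]
      + '[(2 * a) *: (x - p) + e *: x, z - x].
Proof.
move=> Lc [hproper _ _ hconv hstrong] Q hmin.
have hxfin := minimizer_fin_num hproper hmin; split => // z hzfin.
have [v Lv] := adjoint_exists Lc (l + theta *: (L x + s)).
(* The gradient of [Q] at [x]. *)
pose w := v + ((2 * a) *: (x - p) + e *: x).
have hsub : subdifferential h x (- w).
  pose c d := theta / 2 * `|L d| ^+ 2 + a * `|d| ^+ 2 + e / 2 * `|d| ^+ 2.
  apply: (@minimizer_subdifferential _ _ _ _ c hproper hconv hmin) => d t.
  have LD : L (x + t *: d) = L x + t *: L d by rewrite linearD linearZ_LR.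
  rewrite /w /c innerDl -Lv /Q LD !(addrAC _ (t *: L d)) (addrAC _ (t *: d)).
  by rewrite !(sqrnormD _ (t *: _)) -!inner_norm !innerE; field.
have := hstrong z x _ hsub; rewrite -(fineK hxfin) -(fineK hzfin).
rewrite -!EFinB lee_fin innerNl /w innerDl -Lv; lra.
Qed.
End FirstOrder.

(** * One-step inequalities for the primal blocks and the multiplier *)

(* The inertial term [(1 + delta K) f1 - delta K f0] comes from testing the
   subgradient inequality at [xs] and, with weight [delta K], at [x0]. *)
Lemma block_descent {R : realType} {T Z : hilbertType R} (L : {linear T -> Z})
    (delta K c mu e f0 f1 fs : R) (q : Z) (x0 x1 xs u0 u1 dz : T) :
  0 < delta -> 0 <= K -> 0 <= c -> 0 <= mu -> 0 <= e ->
  u1 = x1 + (delta * K) *: (x1 - x0) ->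
  delta *: dz = u1 - u0 + c *: (x1 - x0) ->
  f1 + mu / 2 * `|xs - x1| ^+ 2 <=
    fs + '[q, L (xs - x1)] + '[dz + mu *: (u1 - x1) + e *: x1, xs - x1] ->
  f1 + mu / 2 * `|x0 - x1| ^+ 2 <=
    f0 + '[q, L (x0 - x1)] + '[dz + mu *: (u1 - x1) + e *: x1, x0 - x1] ->
  (1 + delta * K) * f1 - delta * K * f0 - fs + '[q, L (u1 - xs)] <=
    (`|u0 - xs| ^+ 2 - `|u1 - xs| ^+ 2
     + c * (`|x0 - xs| ^+ 2 - `|x1 - xs| ^+ 2)) / (2 * delta)
    + e / 2 * `|xs| ^+ 2
    + e * (delta * K) / 2 * (`|x0| ^+ 2 - `|x1| ^+ 2).
Proof.
move=> d0 K0 c0 mu0 e0 u1E dzE hs h0.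
have dge0 := ltW d0; have dK0 : 0 <= delta * K by rewrite mulr_ge0.
have {h0} := ler_wpM2l dK0 h0; move: hs.
have u1s : u1 - xs = (delta * K) *: (x1 - x0) + (x1 - xs).
  by rewrite u1E addrAC addrC.
have LE : '[q, L (u1 - xs)] =
    - (delta * K * '[q, L (x0 - x1)] + '[q, L (xs - x1)]).
  have LN y z : L (y - z) = - L (z - y) by rewrite -linearN opprB.
  rewrite u1s linearD linearZ_LR !innerE (LN x1 x0) (LN x1 xs) !innerNr.
  by ring.
rewrite LE.
have dzs : dz = delta^-1 *: (u1 - u0 + c *: (x1 - x0)).
  by rewrite -dzE scalerA mulVf ?gt_eqF// scale1r.
have i0 : 0 <= delta^-1 by rewrite invr_ge0 ltW.
(* The facts [q1] to [q7] are the squares left over when each inner product is written as a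
   difference of squared norms; the inequality drops them. *)
have q1 : 0 <= delta^-1 * `|u1 - u0| ^+ 2 by rewrite mulr_ge0.
have q2 : 0 <= delta^-1 * c * (1 + 2 * (delta * K)) * `|x1 - x0| ^+ 2.
  by rewrite !mulr_ge0// addr_ge0// mulr_ge0.
have q3 : 0 <= mu * (delta * K) * `|x1 - x0| ^+ 2 by rewrite !mulr_ge0.
have q4 : 0 <= mu * (`|u1 - x1| ^+ 2 + `|u1 - xs| ^+ 2).
  by rewrite !mulr_ge0// addr_ge0.
have q5 : 0 <= e * `|x1 - xs| ^+ 2 by rewrite !mulr_ge0.
have q6 : 0 <= e * (delta * K) * `|x1 - x0| ^+ 2 by rewrite !mulr_ge0.
have q7 : 0 <= e * `|x1| ^+ 2 by rewrite !mulr_ge0.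
have -> : (2 * delta)^-1 = delta^-1 / 2 by rewrite invfM mulrC.
move: q1 q2 q3 q4 q5 q6 q7.
have -> : u1 - x1 = (delta * K) *: (x1 - x0) by rewrite u1E addrAC subrr add0r.
have -> : u0 - xs = u1 - xs - (u1 - u0).
  by rewrite opprB [RHS]addrC addrA subrK.
rewrite {}dzs {}u1s {LE dzE}.
move: ('[q, L (x0 - x1)]) ('[q, L (xs - x1)]) (u1 - u0) => l0 ls y {u0 u1 u1E}.
(* In the coordinates [p = x1 - xs], [w = x1 - x0], [y = u1 - u0], all terms become linear in
   finitely many scalar monomials. *)
have [p ->] : exists p, x1 = xs + p by exists (x1 - xs); rewrite addrC subrK.
have [w ->] : exists w, x0 = xs + p - w by exists (xs + p - x0); rewrite subKr.
have -> : xs + p - xs = p by rewrite [LHS]addrC addKr.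
have -> : xs - (xs + p) = - p by rewrite opprD addrA subrr add0r.
have -> : xs + p - w - xs = p - w by rewrite -(addrA xs) [LHS]addrC addKr.
have -> : xs + p - (xs + p - w) = w by rewrite subKr.
have -> : xs + p - w - (xs + p) = - w by rewrite [LHS]addrC addKr.
rewrite -!inner_norm !innerE (innerC w p) (innerC y p) (innerC y w).
rewrite (innerC w xs) (innerC p xs).
move: (delta * K) delta^-1 dK0 i0 => P i P0 i0.
move: '[p, p] '[p, w] '[p, y] '[w, w] '[w, y] '[y, y].
move: '[xs, xs] '[xs, p] '[xs, w].
move=> ? ? ? ? ? ? ? ? ?; lra.
Qed.

(** The two sides differ by exactly half of [|a + b0| ^+ 2]. The terms in [b0] and [b1] pay for the
    x-step using the previous y-iterate. *)
Lemma coupling_le {R : realType} {Z : hilbertType R} (l0 l1 ls a b0 b1 : Z) :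
  l1 - l0 = a + b1 ->
  '[ls, a + b1] - '[l1 - (b1 - b0), a] - '[l1, b1] <=
  (`|l0 - ls| ^+ 2 - `|l1 - ls| ^+ 2 + `|b0| ^+ 2 - `|b1| ^+ 2) / 2.
Proof.
move=> E; have -> : l0 = l1 - (a + b1) by rewrite -E opprB addrC subrK.
have := sqr_ge0 `|a + b0|.
rewrite -!inner_norm !innerE ?(innerC ls l1) ?(innerC a l1) ?(innerC b0 l1).
rewrite ?(innerC b1 l1) ?(innerC a ls) ?(innerC b1 ls) ?(innerC b0 a).
rewrite ?(innerC b1 a) ?(innerC b1 b0).
lra.
Qed.

Lemma averaged_norm_le {R : realType} {T : normedModType R} (s w : nat -> T)
    (p q : nat -> R) M :
  (forall n, 0 <= p n) -> (forall n, 0 <= q n) -> (forall n, 0 < p n + q n) ->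
  (forall n, (p n + q n) *: s n.+1 = p n *: s n + q n *: w n) ->
  (forall n, `|w n| <= M) ->
  forall n, `|s n| <= Num.max `|s 0%N| M.
Proof.
move=> p0 q0 pq0 sE wM; elim=> [|n IH]; first by rewrite le_max lexx.
rewrite -(ler_pM2l (pq0 n)) -{1}(ger0_norm (ltW (pq0 n))) -normrZ sE mulrDl.
rewrite (le_trans (ler_normD _ _))// !normrZ !ger0_norm// lerD// ler_wpM2l//.
by rewrite le_max wM orbT.
Qed.

(** Reduces identities between vectors to scalar ones, where [ring] and [field] apply. *)
Lemma inner_inj {R : realType} {T : hilbertType R} (x y : T) :
  (forall z, '[x, z] = '[y, z]) -> x = y.
Proof.
move=> h; apply/eqP; rewrite -subr_eq0 -normr_eq0 -sqrf_eq0 -inner_norm.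
by rewrite innerDl innerNl h subrr.
Qed.

(** With [K = 1 / alpha k = beta k], the proximal gradient becomes the increment of [Zs] (or [Hs])
    plus [mu] times the extrapolation step. *)
Lemma prox_center {R : realType} {T : hilbertType R} (gamma delta mu K : R)
    (x0 x1 z0 : T) : gamma + K + mu * delta * K != 0 ->
  (gamma + K + mu * delta * K) *: (x1 - (x0 +
     (gamma + K + mu * delta * K)^-1 *: (z0 - gamma *: x0))) =
  K *: (x1 - x0) + gamma *: x1 - z0 +
  mu *: (x1 + (delta * K) *: (x1 - x0) - x1).
Proof.
by move=> n0; apply: inner_inj => z; rewrite !innerE; field.
Qed.

Lemma saddle_pointsP {R : realType} {X Y Z : hilbertType R}
    (f : X -> \bar R) (g : Y -> \bar R) (A : X -> Z) (B : Y -> Z) b xs ys lams :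
  proper_fun f -> proper_fun g -> saddle_points f g A B b (xs, ys, lams) ->
  [/\ f xs \is a fin_num, g ys \is a fin_num, residual A B b xs ys = 0 &
    forall x y, f x \is a fin_num -> g y \is a fin_num ->
      0 <= fine (f x) + fine (g y) - (fine (f xs) + fine (g ys))
           + '[lams, residual A B b x y]].
Proof.
move=> [fNy [x0 fx0]] [gNy [y0 gy0]] saddle.
have [fs gs] : f xs \is a fin_num /\ g ys \is a fin_num.
  have [_] := saddle x0 y0 0; rewrite /lagrangian /objective/=.
  move: fx0 gy0 (fNy xs) (gNy ys) (fNy x0) (gNy y0).
  by case: (f xs) (g ys) (f x0) (g y0) => [?| |] [?| |] [?| |] [?| |].
have r0 : residual A B b xs ys = 0.
  (* This choice of multiplier makes the left saddle inequality say that the squared residual is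
     nonpositive. *)
  have [+ _] := saddle xs ys (lams + residual A B b xs ys).
  rewrite /lagrangian /objective/= -(fineK fs) -(fineK gs) -!EFinD lee_fin.
  rewrite lerD2l innerDl gerDl inner_norm => r0.
  apply/eqP; rewrite -normr_eq0 -sqrf_eq0 eq_le r0/=.
  by rewrite sqr_ge0.
split=> // x y fx gy; have [_] := saddle x y 0.
rewrite /lagrangian /objective/= r0 -(fineK fs) -(fineK gs).
rewrite -(fineK fx) -(fineK gy) -!EFinD lee_fin (linear0 (inner lams)).
lra.
Qed.

(** * Optimality conditions and finiteness along the iterates *)

Section Algorithm.
Context {R : realType} {X Y Z : hilbertType R}.
Context (f : X -> \bar R) (g : Y -> \bar R).
Context (A : {linear X -> Z}) (B : {linear Y -> Z}) (b : Z).
Context (A_cont : continuous A) (B_cont : continuous B).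
Context (mu_f mu_g : R) (mu_f_ge0 : 0 <= mu_f) (mu_g_ge0 : 0 <= mu_g).
Context (f_class : strong_class mu_f f) (g_class : strong_class mu_g g).
Context (alpha beta eps : nat -> R).
Context (betaE : forall k, (1 <= k)%N -> beta k = k%:R).
Context (alphaE : forall k, (1 <= k)%N -> alpha k = 1 / k%:R).
Context (delta gamma : R) (delta_gt0 : 0 < delta) (gamma_gt0 : 0 < gamma).
Context (x : nat -> X) (y : nat -> Y) (lam : nat -> Z).
Context (Zs : nat -> X) (Hs : nat -> Y).
Context (algorithm : primal_dual_splitting f g A B b mu_f mu_g delta gamma
                       alpha beta eps x y lam Zs Hs).

(** The point [Zd] or [Hd] of the multiplier update, regrouped. *)
Definition extrapolated {T : lmodType R} (z p : nat -> T) k : T :=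
  z k + delta *: (p k - gamma *: z k).
Let u := extrapolated x Zs.
Let v := extrapolated y Hs.

Let linE := (linearD A, linearN A, linearZ_LR A,
             linearD B, linearN B, linearZ_LR B).

Let k_gt0 k : (1 <= k)%N -> 0 < k%:R :> R.
Proof. by move=> k1; rewrite ltr0n. Qed.

Let alphaV k : (1 <= k)%N -> (alpha k)^-1 = k%:R.
Proof. by move=> k1; rewrite alphaE// div1r invrK. Qed.

Let alpha_beta k : (1 <= k)%N -> alpha k * beta k = 1.
Proof. by move=> k1; rewrite alphaE// betaE// div1r mulVf ?gt_eqF ?k_gt0. Qed.

Lemma extrapolatedS {T : hilbertType R} (z p : nat -> T) k :
  p k.+1 = k%:R *: (z k.+1 - z k) + gamma *: z k.+1 ->
  extrapolated z p k.+1 = z k.+1 + (delta * k%:R) *: (z k.+1 - z k).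
Proof. by move=> pE; rewrite /extrapolated pE addrK scalerA. Qed.

Lemma extrapolatedB {T : hilbertType R} (z p : nat -> T) k :
  delta *: (p k.+1 - p k) = extrapolated z p k.+1 - extrapolated z p k
    + (delta * gamma - 1) *: (z k.+1 - z k).
Proof. by apply: inner_inj => w; rewrite /extrapolated !innerE; ring. Qed.

Lemma ZsS k : (1 <= k)%N -> Zs k.+1 = k%:R *: (x k.+1 - x k) + gamma *: x k.+1.
Proof. by move=> k1; rewrite (pds_Z algorithm k1) alphaV. Qed.

Lemma HsS k : (1 <= k)%N -> Hs k.+1 = k%:R *: (y k.+1 - y k) + gamma *: y k.+1.
Proof. by move=> k1; rewrite (pds_H algorithm k1) alphaV. Qed.

Lemma uS k : (1 <= k)%N -> u k.+1 = x k.+1 + (delta * k%:R) *: (x k.+1 - x k).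
Proof. by move=> k1; apply: extrapolatedS; exact: ZsS. Qed.

Lemma vS k : (1 <= k)%N -> v k.+1 = y k.+1 + (delta * k%:R) *: (y k.+1 - y k).
Proof. by move=> k1; apply: extrapolatedS; exact: HsS. Qed.

Lemma lamS k : (1 <= k)%N ->
  lam k.+1 = lam k + residual A B b (u k.+1) (v k.+1).
Proof.
move=> k1; rewrite (pds_step_lam algorithm k1) alpha_beta// scale1r.
by congr (_ + residual _ _ _ _ _); apply: inner_inj => w;
  rewrite /u /v /extrapolated !innerE; ring.
Qed.

Lemma residual_uv k : (1 <= k)%N -> residual A B b (u k.+1) (v k.+1) =
  residual A B b (x k.+1) (y k.+1) + (delta * k%:R) *:
    (residual A B b (x k.+1) (y k.+1) - residual A B b (x k) (y k)).
Proof.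
move=> k1; rewrite uS// vS// /residual !linE.
by apply: inner_inj => w; rewrite !innerE; ring.
Qed.

(** The x-subproblem only knows [y k], so its effective multiplier lags behind [lam k.+1] by
    [B (v k.+1 - v k)]; the correction term in [lam1] makes this exact. *)
Lemma x_optimality k : (1 <= k)%N -> g (y k) \is a fin_num ->
  f (x k.+1) \is a fin_num /\ forall z, f z \is a fin_num ->
    fine (f (x k.+1)) + mu_f / 2 * `|z - x k.+1| ^+ 2 <= fine (f z)
      + '[lam k.+1 - B (v k.+1 - v k), A (z - x k.+1)]
      + '[Zs k.+1 - Zs k + mu_f *: (u k.+1 - x k.+1) + eps k *: x k.+1,
          z - x k.+1].
Proof.
move=> k1 /fineK; move: (fine _) => c gE.
have := pds_step_x algorithm k1; cbv zeta.
set l1 := (_ - _ + _); set theta := _ * beta k.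
set eta := (_ + _ + _); set xt := _ + eta^-1 *: _ => argminE.
have [] := @strong_class_minimizer _ _ _ A f mu_f (x k.+1) xt l1
  (B (y k) - b) c theta (eta / (2 * alpha k * beta k)) (eps k)
  A_cont f_class.
  move=> z; have : x k.+1 \in [set x k.+1] by rewrite inE.
  rewrite -argminE inE => /(_ z).
  by rewrite /aug_lagrangian /lagrangian /objective /residual -gE
    -!addeA -!EFinD -!addrA.
have -> : l1 + theta *: (A (x k.+1) + (B (y k) - b)) =
    lam k.+1 - B (v k.+1 - v k).
  have -> : theta = 1 + delta * k%:R.
    by rewrite /theta mulrDl alpha_beta// betaE.
  rewrite /l1 -(mulrA delta) alpha_beta// mulr1 betaE// lamS// residual_uv//.
  rewrite vS// /v /extrapolated /residual.
  by rewrite !linE; apply: inner_inj => w; rewrite !innerE; ring.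
suff -> : (2 * (eta / (2 * alpha k * beta k))) *: (x k.+1 - xt) =
    Zs k.+1 - Zs k + mu_f *: (u k.+1 - x k.+1) by [].
rewrite -(mulrA 2 (alpha k)) alpha_beta// mulr1 mulrC divfK ?pnatr_eq0//.
rewrite /xt /eta alphaV// betaE// ZsS// uS// prox_center// gt_eqF//.
by have h0 := k_gt0 k1; rewrite ltr_wpDr ?addr_gt0// !mulr_ge0// ltW.
Qed.

(** Here [x k.+1] is already available, so the effective multiplier is [lam k.+1] itself. *)
Lemma y_optimality k : (1 <= k)%N -> f (x k.+1) \is a fin_num ->
  g (y k.+1) \is a fin_num /\ forall z, g z \is a fin_num ->
    fine (g (y k.+1)) + mu_g / 2 * `|z - y k.+1| ^+ 2 <= fine (g z)
      + '[lam k.+1, B (z - y k.+1)]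
      + '[Hs k.+1 - Hs k + mu_g *: (v k.+1 - y k.+1) + eps k *: y k.+1,
          z - y k.+1].
Proof.
move=> k1 /fineK; move: (fine _) => c fE.
have := pds_step_y algorithm k1; cbv zeta.
set l2 := (_ - _); set theta := _ * beta k.
set eta := (_ + _ + _); set yt := _ + eta^-1 *: _ => argminE.
have [] := @strong_class_minimizer _ _ _ B g mu_g (y k.+1) yt l2
  (A (x k.+1) - b) c theta (eta / (2 * alpha k * beta k)) (eps k)
  B_cont g_class.
  move=> z; have : y k.+1 \in [set y k.+1] by rewrite inE.
  rewrite -argminE inE => /(_ z).
  rewrite /aug_lagrangian /lagrangian /objective /residual -fE.
  rewrite ![A _ + B _ - b]addrAC ![A _ - b + B _]addrC !(addeC c%:E).
  by rewrite -!addeA -!EFinD.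
move=> gyfin h; split=> // z /h.
have -> : l2 + theta *: (B (y k.+1) + (A (x k.+1) - b)) = lam k.+1.
  have -> : theta = 1 + delta * k%:R.
    by rewrite /theta mulrDl alpha_beta// betaE.
  rewrite /l2 betaE// lamS// residual_uv// /residual.
  by apply: inner_inj => w; rewrite !innerE; ring.
suff -> : (2 * (eta / (2 * alpha k * beta k))) *: (y k.+1 - yt) =
    Hs k.+1 - Hs k + mu_g *: (v k.+1 - y k.+1) by [].
rewrite -(mulrA 2 (alpha k)) alpha_beta// mulr1 mulrC divfK ?pnatr_eq0//.
rewrite /yt /eta alphaV// betaE// HsS// vS// prox_center// gt_eqF//.
by have h0 := k_gt0 k1; rewrite ltr_wpDr ?addr_gt0// !mulr_ge0// ltW.
Qed.

(* If [g (y 1)] is infinite, every point solves the first x-subproblem; as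
   [x 2] is its unique solution, [X] is then a singleton contained in the domain
   of [f]. *)
Lemma fin_iterates k : (1 <= k)%N ->
  f (x k.+1) \is a fin_num /\ g (y k.+1) \is a fin_num.
Proof.
elim: k => // k IH _.
suff fx : f (x k.+2) \is a fin_num by split=> //; exact: (y_optimality _ fx).1.
have [gk|gk] := boolP (g (y k.+1) \is a fin_num).
  exact: (x_optimality (ltn0Sn k) gk).1.
have gy : g (y k.+1) = +oo%E.
  have [[gNy _] _ _ _ _] := g_class.
  by move: gk (gNy (y k.+1)); case: (g _).
have [[fNy [z fz]] _ _ _ _] := f_class.
have : z \in [set x k.+2].
  rewrite -(pds_step_x algorithm (ltn0Sn k)) inE => w.
  rewrite /aug_lagrangian /lagrangian /objective gy.
  by rewrite !addey ?fNy// leey.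
rewrite inE => <-; by move: fz (fNy z); case: (f z).
Qed.

(** * Energy estimate *)

Context (epsE : forall k, (1 <= k)%N -> eps k = 1 / k%:R ^+ 3).
Context (delta_le1 : delta <= 1) (delta_gamma : 0 <= delta * gamma - 1).
Context (xs : X) (ys : Y) (lams : Z).
Context (saddle : saddle_points f g A B b (xs, ys, lams)).

Let f_proper : proper_fun f. Proof. by have [] := f_class. Qed.
Let g_proper : proper_fun g. Proof. by have [] := g_class. Qed.

Let r k := residual A B b (x k) (y k).

(** Since [x 1] and [y 1] may lie outside the domains, where [fine] returns a default value, [gap]
    is meaningful from rank 2 on. *)
Definition gap k : R := fine (f (x k)) + fine (g (y k))
  - (fine (f xs) + fine (g ys)) + '[lams, r k].

Let c := delta * gamma - 1.

Definition energy k : R := delta * k%:R * gap k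
  + (`|lam k - lams| ^+ 2 + `|B (v k - ys)| ^+ 2) / 2
  + (`|u k - xs| ^+ 2 + c * `|x k - xs| ^+ 2) / (2 * delta)
  + (`|v k - ys| ^+ 2 + c * `|y k - ys| ^+ 2) / (2 * delta)
  + delta / (2 * k%:R ^+ 2) * (`|x k| ^+ 2 + `|y k| ^+ 2).

Lemma gap_ge0 k : (2 <= k)%N -> 0 <= gap k.
Proof.
case: k => // k k1; have [fk gk] := fin_iterates (k1 : (1 <= k)%N).
have [_ _ _] := saddle_pointsP f_proper g_proper saddle; exact.
Qed.

Let lamS_saddle k : (1 <= k)%N ->
  lam k.+1 - lam k = A (u k.+1 - xs) + B (v k.+1 - ys).
Proof.
move=> k1; rewrite lamS// [X in X - _]addrC addrK.
have [_ _ r0 _] := saddle_pointsP f_proper g_proper saddle.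
rewrite -[LHS]subr0 -r0 /residual !linE.
by apply: inner_inj => w; rewrite !innerE; ring.
Qed.

Lemma lam_residual k : (1 <= k)%N ->
  lam k.+1 - lam k = r k.+1 + (delta * k%:R) *: (r k.+1 - r k).
Proof. by move=> k1; rewrite lamS// residual_uv// [X in X - _]addrC addrK. Qed.

Lemma energy_step k : (2 <= k)%N ->
  energy k.+1 <= energy k + (`|xs| ^+ 2 + `|ys| ^+ 2) / 2 / k%:R ^+ 3.
Proof.
move=> k2; have k1 : (1 <= k)%N by exact: ltnW.
have K0 := k_gt0 k1.
have [fk gk] : f (x k) \is a fin_num /\ g (y k) \is a fin_num.
  by case: k k2 {k1 K0} => // k k1; exact: fin_iterates.
have [fs gs _ _] := saddle_pointsP f_proper g_proper saddle.
have [fk1 hx] := x_optimality k1 gk; have [gk1 hy] := y_optimality k1 fk1.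
have e0 : 0 <= eps k by rewrite epsE// divr_ge0// exprn_ge0// ltW.
have := block_descent delta_gt0 (ltW K0) delta_gamma mu_f_ge0 e0 (uS k1)
  (extrapolatedB x Zs k) (hx _ fs) (hx _ fk).
have := block_descent delta_gt0 (ltW K0) delta_gamma mu_g_ge0 e0 (vS k1)
  (extrapolatedB y Hs k) (hy _ gs) (hy _ gk).
have BvE : B (v k.+1 - v k) = B (v k.+1 - ys) - B (v k - ys).
  by rewrite -linearB opprB addrA subrK.
have := coupling_le lams (B (v k - ys)) (lamS_saddle k1).
(* The pairing with [lams] becomes the same inertial combination as for the function values, so that
   these turn into gaps. *)
rewrite -(lamS_saddle k1) lam_residual//.
rewrite (innerDr lams (r k.+1)) innerZr (innerDr lams (r k.+1) (- r k)).
rewrite (innerNr lams (r k)) -BvE.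
have g1 := gap_ge0 (ltnW k2 : (2 <= k.+1)%N).
(* This uses [delta <= 1] and the nonnegativity of the gap. *)
have : delta * k.+1%:R * gap k.+1 <= (1 + delta * k%:R) * gap k.+1.
  by rewrite ler_wpM2r// -natr1 mulrDr mulr1 [leRHS]addrC lerD2l.
have : delta / (2 * k.+1%:R ^+ 2) * (`|x k.+1| ^+ 2 + `|y k.+1| ^+ 2) <=
       delta / (2 * k%:R ^+ 2) * (`|x k.+1| ^+ 2 + `|y k.+1| ^+ 2).
  rewrite ler_wpM2r ?addr_ge0//  ler_wpM2l ?(ltW delta_gt0)//.
  rewrite lef_pV2 ?posrE ?mulr_gt0 ?exprn_gt0 ?ltr0n// ler_wpM2l//.
  by rewrite ler_pXn2r ?nnegrE// ler_nat.
have -> : eps k * (delta * k%:R) / 2 = delta / (2 * k%:R ^+ 2).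
  by rewrite epsE//; field; rewrite gt_eqF.
have -> : (`|xs| ^+ 2 + `|ys| ^+ 2) / 2 / k%:R ^+ 3 =
  eps k / 2 * `|xs| ^+ 2 + eps k / 2 * `|ys| ^+ 2.
  by rewrite epsE//; field; rewrite gt_eqF.
rewrite /energy /gap -/u -/v -/c -/(r k) -/(r k.+1).
move: (delta / (2 * k.+1%:R ^+ 2)) (delta / (2 * k%:R ^+ 2)) (2 * delta)^-1.
move: (eps k) c k.+1%:R k%:R => e c' K1 K w1 w0 i {hx hy}.
lra.
Qed.

(** The increments [C / k^3] are summable. The induction carries the tail [C / (n + 1)], which
    absorbs them because [1 / (t + 1)^3 + 1 / (t + 1) <= 1 / t]. *)
Lemma energy_bounded : exists M, forall k, (2 <= k)%N -> energy k <= M.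
Proof.
pose C := (`|xs| ^+ 2 + `|ys| ^+ 2) / 2.
have C0 : 0 <= C by rewrite divr_ge0// addr_ge0.
suff h n : energy n.+2 + C / n.+1%:R <= energy 2 + C.
  exists (energy 2 + C) => -[|[|n]]// _.
  by rewrite (le_trans _ (h n))// lerDl divr_ge0.
elim: n => [|n IH]; first by rewrite divr1.
rewrite (le_trans _ IH)//.
have es := energy_step (isT : (2 <= n.+2)%N).
rewrite (le_trans (lerD es (lexx _)))// -/C -addrA lerD2l -mulrDr ler_wpM2l//.
rewrite -[n.+2%:R]natr1; have : 0 < n.+1%:R :> R by rewrite ltr0n.
move: (n.+1%:R) => t t0; rewrite -subr_ge0.
have -> : t^-1 - (((t + 1) ^+ 3)^-1 + (t + 1)^-1) =
    ((t + 1) ^+ 2 - t) / (t * (t + 1) ^+ 3).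
  by field; rewrite !gt_eqF// addr_gt0.
apply: divr_ge0; last by rewrite mulr_ge0 ?exprn_ge0 ?addr_ge0// ltW.
have := sqr_ge0 t; rewrite expr2 sqrrD expr2 mulr1 expr1n mulr2n; lra.
Qed.

Let norm_le_sqr {V : normedModType R} (z w : V) (M : R) :
  `|z - w| ^+ 2 <= M -> `|z| <= `|w| + (M + 1).
Proof.
move=> h; have := ler_normD w (z - w); rewrite addrC subrK => /le_trans; apply.
by rewrite lerD2l; have := normr_ge0 (z - w); nra.
Qed.

(** Every summand of the energy is nonnegative, hence bounded by the energy bound. *)
Lemma gap_lam_uv_bounded : exists M, forall k, (2 <= k)%N ->
  [/\ gap k <= M / k%:R, `|lam k| <= M, `|u k| <= M & `|v k| <= M].
Proof.
have [E EM] := energy_bounded.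
have d2 : 0 < 2 * delta by rewrite mulr_gt0.
pose M1 := `|lams| + (2 * E + 1).
pose M2 := `|xs| + (2 * delta * E + 1).
pose M3 := `|ys| + (2 * delta * E + 1).
exists (`|E / delta| + `|M1| + `|M2| + `|M3|) => k k2.
have k0 : 0 < k%:R :> R by rewrite k_gt0// ltnW.
have := EM _ k2; rewrite /energy.
have : 0 <= delta * k%:R * gap k.
  by rewrite mulr_ge0 ?gap_ge0// mulr_ge0// ltW.
have : 0 <= delta / (2 * k%:R ^+ 2) * (`|x k| ^+ 2 + `|y k| ^+ 2).
  by rewrite mulr_ge0 ?addr_ge0// divr_ge0 ?(ltW delta_gt0)// mulr_ge0.
set h := delta / _ * _ => h0 g0.
have ge0 (z : R) : 0 <= z -> 0 <= z / (2 * delta).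
  by move=> z0; rewrite divr_ge0// ltW.
rewrite !(mulrDl _ _ (2 * delta)^-1).
have := ge0 _ (mulr_ge0 delta_gamma (sqr_ge0 `|x k - xs|)).
have := ge0 _ (mulr_ge0 delta_gamma (sqr_ge0 `|y k - ys|)).
have := ge0 _ (sqr_ge0 `|u k - xs|); have := ge0 _ (sqr_ge0 `|v k - ys|).
rewrite -/c; set qv := `|v k - ys| ^+ 2 / _; set qu := `|u k - xs| ^+ 2 / _.
set qx := c * `|x k - xs| ^+ 2 / _; set qy := c * `|y k - ys| ^+ 2 / _.
move=> qv0 qu0 qy0 qx0 EM'.
have q3 := sqr_ge0 `|lam k - lams|; have q4 := sqr_ge0 `|B (v k - ys)|.
have leM (M : R) : M <= `|M| by exact: ler_norm.
have n1 := normr_ge0 M1; have n2 := normr_ge0 M2; have n3 := normr_ge0 M3.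
have n0 := normr_ge0 (E / delta).
split.
- rewrite ler_pdivlMr// (@le_trans _ _ (E / delta))//.
    by rewrite ler_pdivlMr//; lra.
  by have := leM (E / delta); lra.
- rewrite (@le_trans _ _ M1)//; last by have := leM M1; lra.
  by apply: norm_le_sqr; lra.
- rewrite (@le_trans _ _ M2)//; last by have := leM M2; lra.
  by apply: norm_le_sqr; rewrite mulrC -ler_pdivrMr// -/qu; lra.
- rewrite (@le_trans _ _ M3)//; last by have := leM M3; lra.
  by apply: norm_le_sqr; rewrite mulrC -ler_pdivrMr// -/qv; lra.
Qed.

(** * Boundedness of the iterates and rate of the residual *)

(** When [delta * gamma = 1] the energy gives no uniform bound on [x] and [y]. They are recovered
    from [u] and [v]: [z k.+1] is a convex combination of [z k] and [w k.+1]. *)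
Let conv_bounded {T : hilbertType R} (z w : nat -> T) (M : R) :
  (forall k, (1 <= k)%N ->
    w k.+1 = z k.+1 + (delta * k%:R) *: (z k.+1 - z k)) ->
  (forall k, (2 <= k)%N -> `|w k| <= M) ->
  forall k, (1 <= k)%N -> `|z k| <= Num.max `|z 1%N| M.
Proof.
move=> wE wM -[//|n] _.
apply: (@averaged_norm_le _ _ (fun n => z n.+1) (fun n => w n.+2)
          (fun n => delta * n.+1%:R) (fun=> 1)) => [m|m|m|m|m].
- by rewrite mulr_ge0// ltW.
- by [].
- by rewrite addr_gt0// mulr_gt0// k_gt0.
- by rewrite wE//; apply: inner_inj => t; rewrite !innerE; ring.
- exact: wM.
Qed.

Lemma iterates_bounded : exists M, forall k, (1 <= k)%N ->
  [/\ `|x k| <= M, `|y k| <= M & `|lam k| <= M].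
Proof.
have [M hM] := gap_lam_uv_bounded.
have uM j : (2 <= j)%N -> `|u j| <= M by move=> /hM[].
have vM j : (2 <= j)%N -> `|v j| <= M by move=> /hM[].
have := conv_bounded uS uM; have := conv_bounded vS vM.
move: (Num.max `|x 1%N| M) (Num.max `|y 1%N| M) => Mx My yM xM.
exists (Num.max (Num.max Mx My) (Num.max `|lam 1%N| M)) => k k1.
rewrite !le_max xM// yM// orbT; split=> //.
case: k k1 => [//|[_|k _]]; first by rewrite lexx !orbT.
by have [_ -> _ _] := hM k.+2 isT; rewrite !orbT.
Qed.

(* [delta k r k - lam k] is a weighted average of its predecessor and of
   [- lam k]. *)
Lemma residual_bigO : exists M, forall k, (2 <= k)%N -> `|r k| <= M / k%:R.
Proof.
have [M hM] := iterates_bounded.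
pose s n := (delta * n.+2%:R) *: r n.+2 - lam n.+2.
(* The multiplier update reads [s n = s n.+1 + (1 - delta) *: r n.+3]; eliminating [r n.+3] through
   the definition of [s n.+1] produces this weight, nonnegative as [delta <= 1]. *)
pose q n := (1 - delta) / (delta * n.+3%:R).
have q0 n : 0 <= q n.
  by rewrite divr_ge0 ?subr_ge0// mulr_ge0// ltW.
have sM := @averaged_norm_le _ _ s (fun n => - lam n.+3) (fun=> 1) q M.
have {}sM n : `|s n| <= Num.max `|s 0%N| M.
  apply: sM => // m.
  - by rewrite ltr_wpDr.
  - have lamE : lam m.+2 = lam m.+3 -
      (r m.+3 + (delta * m.+2%:R) *: (r m.+3 - r m.+2)).
      by rewrite -lam_residual// subKr.
    rewrite /s lamE /q -[m.+3%:R]natr1.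
    apply: inner_inj => t; rewrite !innerE.
    have h0 : 0 < m.+2%:R :> R by rewrite ltr0n.
    move: (m.+2%:R) h0 => K K0.
    by field; rewrite !gt_eqF// addr_gt0.
  - by rewrite normrN; have [] := hM m.+3 isT.
exists ((Num.max `|s 0%N| M + M) / delta) => -[|[|n]]// _.
rewrite ler_pdivlMr ?ltr0n// ler_pdivlMr//.
have -> : `|r n.+2| * n.+2%:R * delta = `|(delta * n.+2%:R) *: r n.+2|.
  by rewrite normrZ ger0_norm ?mulr_ge0 ?(ltW delta_gt0)//; ring.
have -> : (delta * n.+2%:R) *: r n.+2 = s n + lam n.+2 by rewrite subrK.
by rewrite (le_trans (ler_normD _ _))// lerD//; have [] := hM n.+2 isT.
Qed.

Lemma gapE k : (2 <= k)%N ->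
  (lagrangian f g A B b (x k) (y k) lams - lagrangian f g A B b xs ys lams =
     (gap k)%:E)%E /\
  (`|objective f g (x k) (y k) - objective f g xs ys| =
     `|gap k - '[lams, r k]|%:E)%E.
Proof.
case: k => // k k1; have [fk gk] := fin_iterates (k1 : (1 <= k)%N).
have [fs gs r0 _] := saddle_pointsP f_proper g_proper saddle.
rewrite /lagrangian /objective r0 /gap -(fineK fk) -(fineK gk) -(fineK fs).
rewrite -(fineK gs) -!EFinD abse_EFin (linear0 (inner lams)).
by split; congr (_%:E); rewrite /r; [|congr `|_|]; rewrite /=; ring.
Qed.
End Algorithm.

(** * Passage to big-O statements and conclusion *)

Lemma bigO_inv_nat {R : realType} (a : nat -> R) M :
  (forall k, (2 <= k)%N -> `|a k| <= M / k%:R) ->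
  a =O_\oo (fun k : nat => 1 / k%:R : R).
Proof.
move=> aM; apply/eqO_exP; exists (`|M| + 1); first by rewrite ltr_wpDl.
exists 2%N => // k /= k2; rewrite (le_trans (aM k k2))// div1r normfV.
rewrite (ger0_norm (ler0n _ k)) ler_wpM2r ?invr_ge0//.
by rewrite (le_trans (ler_norm M))// lerDl.
Qed.

Lemma ereal_bigO_inv_nat {R : realType} (w : nat -> \bar R) (a : nat -> R) M :
  (forall k, (2 <= k)%N -> w k = (a k)%:E /\ `|a k| <= M / k%:R) ->
  ereal_bigO w (fun k => 1 / k%:R).
Proof.
move=> wM; split; first by exists 2%N => // k /= /wM[->].
by apply: (@bigO_inv_nat _ _ M) => k /wM[/= -> aM].
Qed.

Theorem corollary1 (R : realType) (X Y Z : hilbertType R)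
    (f : X -> \bar R) (g : Y -> \bar R)
    (A : {linear X -> Z}) (B : {linear Y -> Z}) (b : Z)
    (A_cont : continuous A) (B_cont : continuous B)
    (solvable : optimal_solutions f g A B b !=set0)
    (mu_f mu_g : R) (mu_f_ge0 : 0 <= mu_f) (mu_g_eq0 : mu_g = 0)
    (f_class : strong_class mu_f f) (g_class : strong_class mu_g g)
    (alpha beta eps : nat -> R)
    (betaE : forall k, (1 <= k)%N -> beta k = k%:R)
    (alphaE : forall k, (1 <= k)%N -> alpha k = 1 / k%:R)
    (epsE : forall k, (1 <= k)%N -> eps k = 1 / k%:R ^+ 3)
    (delta gamma : R) (delta_gt0 : 0 < delta) (gamma_gt0 : 0 < gamma)
    (delta_le1 : delta <= 1) (delta_gamma : 0 <= delta * gamma - 1)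
    (x : nat -> X) (y : nat -> Y) (lam : nat -> Z)
    (Zs : nat -> X) (Hs : nat -> Y)
    (algorithm : primal_dual_splitting f g A B b mu_f mu_g delta gamma
                   alpha beta eps x y lam Zs Hs)
    (xs : X) (ys : Y) (lams : Z)
    (saddle : saddle_points f g A B b (xs, ys, lams)) :
  [/\ [bounded (x k, y k, lam k) | k in [set k : nat | (1 <= k)%N]],
      ereal_bigO
        (fun k => (lagrangian f g A B b (x k) (y k) lams
                   - lagrangian f g A B b xs ys lams)%E)
        (fun k => 1 / k%:R),
      ereal_bigO
        (fun k => `|objective f g (x k) (y k) - objective f g xs ys|%E)
        (fun k => 1 / k%:R) &
      (fun k => `|A (x k) + B (y k) - b|) =O_\oo (fun k : nat => 1 / k%:R : R)].
Proof.
have mu_g_ge0 : 0 <= mu_g by rewrite mu_g_eq0.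
pose F := gap f g A B b x y xs ys lams.
have [Mz zM] := iterates_bounded A_cont B_cont mu_f_ge0 mu_g_ge0 f_class g_class
  betaE alphaE delta_gt0 gamma_gt0 algorithm epsE delta_le1 delta_gamma saddle.
have [Mr rM] := residual_bigO A_cont B_cont mu_f_ge0 mu_g_ge0 f_class g_class
  betaE alphaE delta_gt0 gamma_gt0 algorithm epsE delta_le1 delta_gamma saddle.
have [Mg gM] := gap_lam_uv_bounded A_cont B_cont mu_f_ge0 mu_g_ge0 f_class
  g_class betaE alphaE delta_gt0 gamma_gt0 algorithm epsE delta_le1 delta_gamma
  saddle.
have FE := gapE A_cont B_cont mu_f_ge0 mu_g_ge0 f_class g_class
  betaE alphaE delta_gt0 gamma_gt0 algorithm saddle.
have FM k : (2 <= k)%N -> `|F k| <= Mg / k%:R.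
  move=> k2; have [Fk _ _ _] := gM k k2; rewrite ger0_norm//.
  exact: (gap_ge0 A_cont B_cont mu_f_ge0 mu_g_ge0 f_class g_class
    betaE alphaE delta_gt0 gamma_gt0 algorithm saddle).
split.
- exists Mz; split; first exact: num_real.
  move=> M MzM k /= /zM[xM yM lamM]; rewrite !prod_normE/= !ge_max.
  by rewrite !(le_trans _ (ltW MzM)).
- by apply: (@ereal_bigO_inv_nat _ _ F Mg) => k k2; split; [exact: (FE k k2).1|
    exact: FM].
(* The objective difference is the gap minus ['[lams, r k]], which Cauchy-Schwarz bounds through the
   residual. *)
- apply: (@ereal_bigO_inv_nat _ _ _ (Mg + `|lams| * Mr)) => k k2; split.
    exact: (FE k k2).2.
  rewrite normr_id (le_trans (ler_normB _ _))// mulrDl lerD ?FM//.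
  by rewrite (le_trans (abs_inner_le_norm _ _))// -mulrA ler_wpM2l// rM.
- by apply: (@bigO_inv_nat _ _ Mr) => k /rM; rewrite normr_id.
Qed.
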